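(* If $R$ is a finite field with $p^{n}$ elements, where $p$ is its characteristic, then there is an isomorphism of Tall–Wraith monoids (for commutative unital $R$-algebras) $$\eta_R\colon R[x]/(x^{p^{n}}-x)\to\mathrm{Hom}_{\mathrm{Set}}(|R|,|R|),$$ which sends (the equivalence class of) $x$ to the identity morphism on $|R|$.
   Context: Let $\mathcal B$ be the category of commutative unital $R$-algebras. A co-$\mathcal B$-algebra object in $\mathcal B$ is an $R$-algebra $T$ with co-operations dual to the $R$-algebra operations, equivalently with a lift of $\mathrm{Hom}_{\mathcal B}(T,-)$ to a functor $\mathcal B\to\mathcal B$; $\mathrm{Hom}_{\mathcal B}(T,B)$ denotes the resulting $R$-algebra. The Tall–Wraith product $\odot$ of such objects is characterised by $\mathrm{Hom}_{\mathcal B}(T_1\odot T_2,B)\cong\mathrm{Hom}_{\mathcal B}(T_1,\mathrm{Hom}_{\mathcal B}(T_2,B))$, the unit object $I$ represents the identity functor, and a Tall–Wraith monoid here is a monoid for $\odot$; an isomorphism of Tall–Wraith monoids is an isomorphism of $R$-algebras respecting all co-operations and the monoid structure. $R[x]$ is the unit object $I$ and hence a Tall–Wraith monoid: coaddition $\Delta^{+}x=1\otimes x+x\otimes1$, comultiplication $\Delta^{\times}x=x\otimes x$, for each $r\in R$ the map $\epsilon_r\colon R[x]\to R$ evaluating at $r$, and monoid multiplication given by composition of polynomials, with unit $x$. The quotient $R[x]/(x^{p^{n}}-x)$ carries the Tall–Wraith monoid structure inherited from $R[x]$. $\mathrm{Hom}_{\mathrm{Set}}(|R|,|R|)$ is the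 $R$-algebra of functions $|R|\to R$ (pointwise operations); since $R$ is finite, $\mathrm{Hom}_{\mathrm{Set}}(|R|,R)^{\otimes_R k}\cong\mathrm{Hom}_{\mathrm{Set}}(|R|^{k},R)$, and the co-operation corresponding to a $k$-ary $R$-algebra operation $\omega\colon|R|^{k}\to|R|$ is precomposition with $\omega$; the monoid structure is given by composition of functions, with unit the identity function. *)

(* Defs.v *)
From HB Require Import structures.
From mathcomp Require Import all_boot all_algebra finfield.
From mathcomp Require Import boolp functions.

Set Implicit Arguments.
Unset Strict Implicit.
Unset Printing Implicit Defensive.

Import GRing.Theory.
Local Open Scope ring_scope.
Local Open Scope quotient_scope.

(** * Commutative unital R-algebras *)

(* The library's [comAlgType R] excludes the zero ring, which is an object of
   the category of commutative unital R-algebras.  We therefore take algebras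
   to be possibly trivial commutative rings under R. *)
Record calg (R : comNzRingType) := CAlg {
  calg_sort :> comPzRingType;
  calg_in : {rmorphism R -> calg_sort} }.

Record ahom (R : comNzRingType) (A B : calg R) := AHom {
  ahom_mor :> {rmorphism A -> B};
  ahom_in : forall r, ahom_mor (calg_in A r) = calg_in B r }.

Section Hom.
Variable R : comNzRingType.
Implicit Types A B C D : calg R.

Lemma ahom_ext A B (f g : ahom A B) : (forall x, f x = g x) -> f = g.
Proof.
case: f g => [[f [[fa] [fm]]] fi] [[g [[ga] [gm]]] gi] /= fg.
have {}fg : f = g by apply: funext.
subst g; have ? := Prop_irrelevance fa ga; have ? := Prop_irrelevance fm gm.
by subst ga gm; rewrite (Prop_irrelevance fi gi).
Qed.

Section Build.
Variables (A B : calg R) (f : A -> B).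
Hypothesis fD : forall x y, f (x + y) = f x + f y.
Hypothesis fM : forall x y, f (x * y) = f x * f y.
Hypothesis fi : forall r, f (calg_in A r) = calg_in B r.

Let f_nmod : nmod_morphism f.
Proof. by split=> [|//]; rewrite -(rmorph0 (calg_in A)) fi rmorph0. Qed.
Let f_monoid : monoid_morphism f.
Proof. by split=> [|//]; rewrite -(rmorph1 (calg_in A)) fi rmorph1. Qed.
HB.instance Definition _ := GRing.isNmodMorphism.Build A B f f_nmod.
HB.instance Definition _ := GRing.isMonoidMorphism.Build A B f f_monoid.

Definition mk_ahom : ahom A B := @AHom R A B f fi.

End Build.

Definition aid A : ahom A A := @AHom R A A idfun (fun=> erefl).

Fact acomp_in A B C (g : ahom B C) (f : ahom A B) r :
  (g \o f) (calg_in A r) = calg_in C r.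
Proof. by rewrite /= !ahom_in. Qed.
Definition acomp A B C (g : ahom B C) (f : ahom A B) : ahom A C :=
  AHom (acomp_in g f).

Definition base : calg R := @CAlg R R idfun.

Fact ainit_in A r : calg_in A (calg_in base r) = calg_in A r.
Proof. by []. Qed.
Definition ainit A : ahom base A := @AHom R base A (calg_in A) (@ainit_in A).

Lemma acompA A B C D (h : ahom C D) (g : ahom B C) (f : ahom A B) :
  acomp h (acomp g f) = acomp (acomp h g) f.
Proof. exact: ahom_ext. Qed.

Lemma acomp_ainit A B (f : ahom A B) : acomp f (ainit A) = ainit B.
Proof. by apply: ahom_ext => r /=; rewrite ahom_in. Qed.

End Hom.

Notation "g \c f" := (acomp g f) (at level 50, left associativity).

(** * Algebras presented by a class of valuations

   [pres P] is the R-algebra generated by G and universal for the valuations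
   v : G -> B satisfying P: formal R-algebra expressions over G, two of them
   being identified when all the valuations satisfying P give them the same
   value. *)

Inductive term (R : comNzRingType) (G : Type) : Type :=
| Gen of G
| Cst of R
| Add of term R G & term R G
| Mul of term R G & term R G.
Arguments Gen {R G}.
Arguments Cst {R G}.

HB.instance Definition _ (R : comNzRingType) (G : Type) :=
  gen_eqMixin (term R G).
HB.instance Definition _ (R : comNzRingType) (G : Type) :=
  gen_choiceMixin (term R G).

Fixpoint eval (R : comNzRingType) (G : Type) (B : calg R) (v : G -> B)
    (t : term R G) : B :=
  match t with
  | Gen g => v g
  | Cst r => calg_in B r
  | Add s t => eval v s + eval v t
  | Mul s t => eval v s * eval v t
  end.

Section Presented.
Variables (R : comNzRingType) (G : Type).
Variable P : forall B : calg R, (G -> B) -> Prop.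

Definition term_eq (s t : term R G) : bool :=
  `[< forall (B : calg R) (v : G -> B), P v -> eval v s = eval v t >].

Fact term_eq_refl : reflexive term_eq.
Proof. by move=> s; apply/asboolP. Qed.
Fact term_eq_sym : symmetric term_eq.
Proof.
by move=> s t; apply/asboolP/asboolP => e B v Pv; rewrite e.
Qed.
Fact term_eq_trans : transitive term_eq.
Proof.
move=> t s u /asboolP st /asboolP tu; apply/asboolP => B v Pv.
by rewrite st ?tu.
Qed.
Canonical term_equiv := EquivRel term_eq term_eq_refl term_eq_sym term_eq_trans.

Definition pres_sort := {eq_quot term_equiv}.
HB.instance Definition _ := Choice.on pres_sort.

Definition pclass (t : term R G) : pres_sort := \pi_{eq_quot term_equiv} t.
Definition prepr (x : pres_sort) : term R G :=
  repr (x : {eq_quot term_equiv}).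
Definition pval (B : calg R) (v : G -> B) (x : pres_sort) : B :=
  eval v (prepr x).

Lemma preprK x : pclass (prepr x) = x.
Proof. exact: reprK. Qed.

Lemma pvalE (B : calg R) (v : G -> B) t : P v -> pval v (pclass t) = eval v t.
Proof.
move=> Pv; have /eqmodP/asboolP : prepr (pclass t) = t %[mod {eq_quot term_equiv}].
  exact: preprK.
exact.
Qed.

Lemma pres_ext (x y : pres_sort) :
  (forall (B : calg R) (v : G -> B), P v -> pval v x = pval v y) -> x = y.
Proof.
move=> xy; rewrite -[x]preprK -[y]preprK.
by apply/eqmodP/asboolP => B v Pv; apply: xy.
Qed.

Definition padd (x y : pres_sort) : pres_sort := pclass (Add (prepr x) (prepr y)).
Definition pmul (x y : pres_sort) : pres_sort := pclass (Mul (prepr x) (prepr y)).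
Definition popp (x : pres_sort) : pres_sort := pclass (Mul (Cst (-1)) (prepr x)).
Definition pcst (r : R) : pres_sort := pclass (Cst r).

Section Val.
Variables (B : calg R) (v : G -> B).
Hypothesis Pv : P v.
Fact pvalD x y : pval v (padd x y) = pval v x + pval v y.
Proof. by rewrite pvalE. Qed.
Fact pvalM x y : pval v (pmul x y) = pval v x * pval v y.
Proof. by rewrite pvalE. Qed.
Fact pvalN x : pval v (popp x) = - pval v x.
Proof. by rewrite pvalE //= rmorphN rmorph1 mulN1r. Qed.
Fact pvalC r : pval v (pcst r) = calg_in B r.
Proof. by rewrite pvalE. Qed.
End Val.

Fact paddA : associative padd.
Proof. by move=> x y z; apply: pres_ext => B v Pv; rewrite !pvalD // addrA. Qed.
Fact paddC : commutative padd.
Proof. by move=> x y; apply: pres_ext => B v Pv; rewrite !pvalD // addrC. Qed.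
Fact padd0 : left_id (pcst 0) padd.
Proof.
by move=> x; apply: pres_ext => B v Pv; rewrite pvalD // pvalC // rmorph0 add0r.
Qed.
Fact paddN : left_inverse (pcst 0) popp padd.
Proof.
move=> x; apply: pres_ext => B v Pv.
by rewrite pvalD // pvalN // pvalC // rmorph0 addNr.
Qed.
HB.instance Definition _ :=
  GRing.isZmodule.Build pres_sort paddA paddC padd0 paddN.

Fact pmulA : associative pmul.
Proof. by move=> x y z; apply: pres_ext => B v Pv; rewrite !pvalM // mulrA. Qed.
Fact pmulC : commutative pmul.
Proof. by move=> x y; apply: pres_ext => B v Pv; rewrite !pvalM // mulrC. Qed.
Fact pmul1 : left_id (pcst 1) pmul.
Proof.
by move=> x; apply: pres_ext => B v Pv; rewrite pvalM // pvalC // rmorph1 mul1r.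
Qed.
Fact pmulD : left_distributive pmul +%R.
Proof.
move=> x y z; apply: pres_ext => B v Pv.
by rewrite [RHS]pvalD // !pvalM // pvalD // mulrDl.
Qed.
HB.instance Definition _ :=
  GRing.Zmodule_isComPzRing.Build pres_sort pmulA pmulC pmul1 pmulD.

Fact pcst_nmod : nmod_morphism pcst.
Proof.
by split=> // r s; apply: pres_ext => B v Pv; rewrite pvalD // !pvalC // rmorphD.
Qed.
Fact pcst_monoid : monoid_morphism pcst.
Proof.
by split=> // r s; apply: pres_ext => B v Pv; rewrite pvalM // !pvalC // rmorphM.
Qed.
HB.instance Definition _ := GRing.isNmodMorphism.Build R pres_sort pcst pcst_nmod.
HB.instance Definition _ :=
  GRing.isMonoidMorphism.Build R pres_sort pcst pcst_monoid.

Definition pres : calg R := @CAlg R pres_sort pcst.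

Definition pgen (g : G) : pres := pclass (Gen g).

Definition plift (B : calg R) (v : G -> B) (Pv : P v) : ahom pres B :=
  @mk_ahom R pres B (pval v) (pvalD Pv) (pvalM Pv) (pvalC Pv).

Lemma plift_gen (B : calg R) (v : G -> B) (Pv : P v) g :
  plift Pv (pgen g) = v g.
Proof. by rewrite /= pvalE. Qed.

Lemma pres_hom_ext (B : calg R) (f g : ahom pres B) :
  (forall x, f (pgen x) = g (pgen x)) -> f = g.
Proof.
move=> fg; apply: ahom_ext => x; rewrite -[x]preprK.
elim: (prepr x) => [y|r|s IHs t IHt|s IHs t IHt]; first exact: fg.
- by rewrite !(ahom_in _ r).
- have -> : pclass (Add s t) = (pclass s : pres) + pclass t.
    by apply: pres_ext => C v Pv; rewrite [RHS]pvalD // !pvalE.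
  by rewrite !rmorphD IHs IHt.
- have -> : pclass (Mul s t) = (pclass s : pres) * pclass t.
    by apply: pres_ext => C v Pv; rewrite [RHS]pvalM // !pvalE.
  by rewrite !rmorphM IHs IHt.
Qed.

End Presented.

(** * The tensor product over R, i.e. the coproduct of R-algebras *)

Section Tensor.
Variable R : comNzRingType.
Implicit Types A B C D : calg R.

Definition tensor_val A B C (v : A + B -> C) : Prop :=
  (exists f : ahom A C, forall a, v (inl a) = f a) /\
  (exists g : ahom B C, forall b, v (inr b) = g b).

Definition tensor A B : calg R := pres (@tensor_val A B).

Section Inj.
Variables A B : calg R.
Let P := @tensor_val A B.

Fact tinlD a a' :
  pgen P (inl (a + a')) = pgen P (inl a) + pgen P (inl a').
Proof.
apply: pres_ext => C v Pv; rewrite [RHS]pvalD // !pvalE //=.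
by case: Pv => [[f vf] _]; rewrite !vf rmorphD.
Qed.
Fact tinlM a a' :
  pgen P (inl (a * a')) = pgen P (inl a) * pgen P (inl a').
Proof.
apply: pres_ext => C v Pv; rewrite [RHS]pvalM // !pvalE //=.
by case: Pv => [[f vf] _]; rewrite !vf rmorphM.
Qed.
Fact tinl_in r : pgen P (inl (calg_in A r)) = calg_in (pres P) r.
Proof.
apply: pres_ext => C v Pv; rewrite [RHS]pvalC // !pvalE //=.
by case: Pv => [[f vf] _]; rewrite !vf ahom_in.
Qed.
Fact tinrD b b' :
  pgen P (inr (b + b')) = pgen P (inr b) + pgen P (inr b').
Proof.
apply: pres_ext => C v Pv; rewrite [RHS]pvalD // !pvalE //=.
by case: Pv => [_ [f vf]]; rewrite !vf rmorphD.
Qed.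
Fact tinrM b b' :
  pgen P (inr (b * b')) = pgen P (inr b) * pgen P (inr b').
Proof.
apply: pres_ext => C v Pv; rewrite [RHS]pvalM // !pvalE //=.
by case: Pv => [_ [f vf]]; rewrite !vf rmorphM.
Qed.
Fact tinr_in r : pgen P (inr (calg_in B r)) = calg_in (pres P) r.
Proof.
apply: pres_ext => C v Pv; rewrite [RHS]pvalC // !pvalE //=.
by case: Pv => [_ [f vf]]; rewrite !vf ahom_in.
Qed.

(* a |-> a (x) 1 and b |-> 1 (x) b *)
Definition tinl : ahom A (tensor A B) :=
  @mk_ahom R A (pres P) (fun a => pgen P (inl a)) tinlD tinlM tinl_in.
Definition tinr : ahom B (tensor A B) :=
  @mk_ahom R B (pres P) (fun b => pgen P (inr b)) tinrD tinrM tinr_in.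

Definition tens (a : A) (b : B) : tensor A B := tinl a * tinr b.

Section Copair.
Variables (C : calg R) (f : ahom A C) (g : ahom B C).

Definition copair_fun (x : A + B) : C :=
  match x with inl a => f a | inr b => g b end.
Fact copair_val : P copair_fun.
Proof. by split; [exists f | exists g]. Qed.

Definition copair : ahom (tensor A B) C := plift copair_val.

Lemma copair_inl : copair \c tinl = f.
Proof. by apply: ahom_ext => a; rewrite /= pvalE //; apply: copair_val. Qed.
Lemma copair_inr : copair \c tinr = g.
Proof. by apply: ahom_ext => a; rewrite /= pvalE //; apply: copair_val. Qed.

Lemma copair_uniq (h : ahom (tensor A B) C) :
  h \c tinl = f -> h \c tinr = g -> h = copair.
Proof.
move=> hf hg; apply: pres_hom_ext => -[a|b]; rewrite plift_gen /= -?hf -?hg //.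
Qed.

Lemma copair_tens a b : copair (tens a b) = f a * g b.
Proof. by rewrite rmorphM -[in RHS]copair_inl -[in RHS]copair_inr. Qed.

End Copair.

Lemma copair_id : copair tinl tinr = aid (tensor A B).
Proof. by apply/esym/copair_uniq; apply: ahom_ext. Qed.

Lemma acomp_copair C D (k : ahom C D) (f : ahom A C) (g : ahom B C) :
  k \c copair f g = copair (k \c f) (k \c g).
Proof.
by apply: copair_uniq; rewrite -acompA ?copair_inl ?copair_inr.
Qed.

End Inj.

Definition tmap A B C D (f : ahom A C) (g : ahom B D) :
    ahom (tensor A B) (tensor C D) :=
  copair (tinl C D \c f) (tinr C D \c g).

Lemma copair_tmap A B C D E (f : ahom A C) (g : ahom B D)
    (h : ahom C E) (k : ahom D E) :
  copair h k \c tmap f g = copair (h \c f) (k \c g).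
Proof. by rewrite acomp_copair !acompA copair_inl copair_inr. Qed.

Lemma tmap_id A B : tmap (aid A) (aid B) = aid (tensor A B).
Proof. by apply/esym/copair_uniq; apply: ahom_ext. Qed.

End Tensor.

Arguments tinl {R A B}.
Arguments tinr {R A B}.

(** * Co-B-algebra objects *)

(* The operations of R-algebras are +, -, * and the constants r in R (among
   them 0 and 1); scalar multiplication is multiplication by a constant. *)
Record co_ops (R : comNzRingType) (T : calg R) := CoOps {
  coadd : ahom T (tensor T T);
  coopp : ahom T T;
  comul : ahom T (tensor T T);
  cocst : R -> ahom T (base R) }.

Section Convolution.
Variables (R : comNzRingType) (T : calg R) (o : co_ops T) (B : calg R).
Implicit Types f g : ahom T B.

(* the operations induced on Hom(T, B) *)
Definition hadd f g : ahom T B := copair f g \c coadd o.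
Definition hopp f : ahom T B := f \c coopp o.
Definition hmul f g : ahom T B := copair f g \c comul o.
Definition hcst (r : R) : ahom T B := ainit B \c cocst o r.

End Convolution.

Lemma acomp_hadd R (T : calg R) (o : co_ops T) B C (k : ahom B C)
  (f g : ahom T B) : k \c hadd o f g = hadd o (k \c f) (k \c g).
Proof. by rewrite /hadd acompA acomp_copair. Qed.
Lemma acomp_hopp R (T : calg R) (o : co_ops T) B C (k : ahom B C)
  (f : ahom T B) : k \c hopp o f = hopp o (k \c f).
Proof. by rewrite /hopp acompA. Qed.
Lemma acomp_hmul R (T : calg R) (o : co_ops T) B C (k : ahom B C)
  (f g : ahom T B) : k \c hmul o f g = hmul o (k \c f) (k \c g).
Proof. by rewrite /hmul acompA acomp_copair. Qed.
Lemma acomp_hcst R (T : calg R) (o : co_ops T) B C (k : ahom B C) r :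
  k \c hcst o B r = hcst o C r.
Proof. by rewrite /hcst acompA acomp_ainit. Qed.

(* By the Yoneda lemma, the identities dual to those of commutative R-algebras
   hold for the co-operations of T if and only if the induced operations make
   all the sets Hom(T, B) commutative R-algebras. *)
Record co_laws (R : comNzRingType) (T : calg R) (o : co_ops T) : Prop := CoLaws {
  haddA : forall B, associative (@hadd R T o B);
  haddC : forall B, commutative (@hadd R T o B);
  hadd0 : forall B, left_id (hcst o B 0) (@hadd R T o B);
  haddN : forall B, left_inverse (hcst o B 0) (@hopp R T o B) (@hadd R T o B);
  hmulA : forall B, associative (@hmul R T o B);
  hmulC : forall B, commutative (@hmul R T o B);
  hmul1 : forall B, left_id (hcst o B 1) (@hmul R T o B);
  hmulD : forall B, left_distributive (@hmul R T o B) (@hadd R T o B);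
  hcstD : forall B r s, hcst o B (r + s) = hadd o (hcst o B r) (hcst o B s);
  hcstM : forall B r s, hcst o B (r * s) = hmul o (hcst o B r) (hcst o B s) }.

Record coalg (R : comNzRingType) := Coalg {
  coalg_alg :> calg R;
  coalg_ops : co_ops coalg_alg;
  coalg_laws : co_laws coalg_ops }.

(* The R-algebra Hom(T, B) *)
Definition hom_sort (R : comNzRingType) (T : coalg R) (B : calg R) : Type :=
  ahom T B.
HB.instance Definition _ R (T : coalg R) B := gen_eqMixin (hom_sort T B).
HB.instance Definition _ R (T : coalg R) B := gen_choiceMixin (hom_sort T B).

Section HomAlg.
Variables (R : comNzRingType) (T : coalg R) (B : calg R).
Let o := coalg_ops T.
Let l := coalg_laws T.

HB.instance Definition _ := GRing.isZmodule.Build (hom_sort T B)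
  (@haddA _ _ _ l B) (@haddC _ _ _ l B) (@hadd0 _ _ _ l B) (@haddN _ _ _ l B).
HB.instance Definition _ := GRing.Zmodule_isComPzRing.Build (hom_sort T B)
  (@hmulA _ _ _ l B) (@hmulC _ _ _ l B) (@hmul1 _ _ _ l B) (@hmulD _ _ _ l B).

Definition hom_cst (r : R) : hom_sort T B := hcst o B r.
Fact hom_cst_nmod : nmod_morphism hom_cst.
Proof. by split=> // r s; apply: (hcstD l). Qed.
Fact hom_cst_monoid : monoid_morphism hom_cst.
Proof. by split=> // r s; apply: (hcstM l). Qed.
HB.instance Definition _ :=
  GRing.isNmodMorphism.Build R (hom_sort T B) hom_cst hom_cst_nmod.
HB.instance Definition _ :=
  GRing.isMonoidMorphism.Build R (hom_sort T B) hom_cst hom_cst_monoid.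

Definition homalg : calg R := @CAlg R (hom_sort T B) hom_cst.

End HomAlg.

Definition postcomp (R : comNzRingType) (T : coalg R) (B C : calg R)
    (k : ahom B C) : ahom (homalg T B) (homalg T C) :=
  @mk_ahom R (homalg T B) (homalg T C) (fun f => k \c (f : ahom T B))
    (acomp_hadd (coalg_ops T) k) (acomp_hmul (coalg_ops T) k)
    (acomp_hcst (coalg_ops T) k).

(** * Morphisms of co-B-algebra objects *)

Record cohom (R : comNzRingType) (T S : coalg R) := CoHom {
  cohom_ahom :> ahom T S;
  cohom_add : coadd (coalg_ops S) \c cohom_ahom =
    tmap cohom_ahom cohom_ahom \c coadd (coalg_ops T);
  cohom_opp : coopp (coalg_ops S) \c cohom_ahom =
    cohom_ahom \c coopp (coalg_ops T);
  cohom_mul : comul (coalg_ops S) \c cohom_ahom =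
    tmap cohom_ahom cohom_ahom \c comul (coalg_ops T);
  cohom_cst : forall r, cocst (coalg_ops S) r \c cohom_ahom =
    cocst (coalg_ops T) r }.

Section Cohom.
Variables (R : comNzRingType).
Implicit Types T S U : coalg R.

Definition cohom_id T : cohom T T.
Proof.
by apply: (@CoHom R T T (aid T)) => *; rewrite ?tmap_id; apply: ahom_ext.
Defined.

Section Precomp.
Variables (T S : coalg R) (f : cohom T S) (B : calg R).
Let oS := coalg_ops S.
Let oT := coalg_ops T.

Fact precompD (u v : ahom S B) : hadd oS u v \c f = hadd oT (u \c f) (v \c f).
Proof. by rewrite /hadd -acompA cohom_add acompA copair_tmap. Qed.
Fact precompM (u v : ahom S B) : hmul oS u v \c f = hmul oT (u \c f) (v \c f).
Proof. by rewrite /hmul -acompA cohom_mul acompA copair_tmap. Qed.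
Fact precomp_in r : hcst oS B r \c f = hcst oT B r.
Proof. by rewrite /hcst -acompA cohom_cst. Qed.

Definition precomp : ahom (homalg S B) (homalg T B) :=
  @mk_ahom R (homalg S B) (homalg T B) (fun u => (u : ahom S B) \c f)
    precompD precompM precomp_in.

End Precomp.

(* conversely, a map is a morphism as soon as precomposition with it preserves
   the induced operations *)
Lemma mk_cohom T S (f : ahom T S)
  (oS := coalg_ops S) (oT := coalg_ops T) :
  (forall B (u v : ahom S B), hadd oS u v \c f = hadd oT (u \c f) (v \c f)) ->
  (forall B (u : ahom S B), hopp oS u \c f = hopp oT (u \c f)) ->
  (forall B (u v : ahom S B), hmul oS u v \c f = hmul oT (u \c f) (v \c f)) ->
  (forall B r, hcst oS B r \c f = hcst oT B r) ->
  cohom T S.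
Proof.
move=> fD fN fM fi; apply: (@CoHom R T S f).
- have := fD _ tinl tinr; rewrite /hadd copair_id => <-; exact: ahom_ext.
- have := fN _ (aid S); rewrite /hopp => e.
  apply: ahom_ext => x; move/(congr1 (fun h : ahom T S => h x)): e.
  by [].
- have := fM _ tinl tinr; rewrite /hmul copair_id => <-; exact: ahom_ext.
- by move=> r; apply: ahom_ext => x; move/(congr1 (fun h : ahom T (base R) => h x)): (fi (base R) r).
Defined.

End Cohom.

(** * The Tall-Wraith product *)

Section Odot.
Variables (R : comNzRingType) (T1 T2 : coalg R).

(* T1 (.) T2 is generated by symbols t1 (.) t2 and classifies the R-algebra
   homomorphisms F : T1 -> Hom(T2, B), through t1 (.) t2 |-> F t1 t2. *)
Definition odot_val (B : calg R) (v : T1 * T2 -> B) : Prop :=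
  exists F : ahom T1 (homalg T2 B), forall a b, v (a, b) = (F a : ahom T2 B) b.

Definition odot_alg : calg R := pres odot_val.

Definition ogen (a : T1) (b : T2) : odot_alg := pgen odot_val (a, b).

Definition uncurry_fun B (F : ahom T1 (homalg T2 B)) (x : T1 * T2) : B :=
  (F x.1 : ahom T2 B) x.2.
Fact uncurry_val B (F : ahom T1 (homalg T2 B)) : odot_val (uncurry_fun F).
Proof. by exists F. Qed.

Definition ouncurry B (F : ahom T1 (homalg T2 B)) : ahom odot_alg B :=
  plift (uncurry_val F).

Lemma ouncurryE B (F : ahom T1 (homalg T2 B)) a b :
  ouncurry F (ogen a b) = (F a : ahom T2 B) b.
Proof. exact: plift_gen. Qed.

Lemma odot_ext (x y : odot_alg) :
  (forall B (F : ahom T1 (homalg T2 B)), ouncurry F x = ouncurry F y) -> x = y.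
Proof.
move=> xy; apply: pres_ext => B v [F vF].
have -> : v = uncurry_fun F by apply: funext => -[a b]; rewrite vF.
exact: xy.
Qed.

Section Univ.
Variable a : T1.
Fact ogenrD b b' : ogen a (b + b') = ogen a b + ogen a b'.
Proof. by apply: odot_ext => B F; rewrite rmorphD !ouncurryE rmorphD. Qed.
Fact ogenrM b b' : ogen a (b * b') = ogen a b * ogen a b'.
Proof. by apply: odot_ext => B F; rewrite rmorphM !ouncurryE rmorphM. Qed.
Fact ogenr_in r : ogen a (calg_in T2 r) = calg_in odot_alg r.
Proof. by apply: odot_ext => B F; rewrite ouncurryE !ahom_in. Qed.
Definition ogenr : ahom T2 odot_alg := mk_ahom ogenrD ogenrM ogenr_in.
End Univ.

Lemma postcomp_ogenr B (F : ahom T1 (homalg T2 B)) a :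
  postcomp T2 (ouncurry F) (ogenr a) = F a.
Proof. by apply: ahom_ext => b; apply: (ouncurryE F a b). Qed.

Lemma hom_odot_ext (f g : homalg T2 odot_alg) :
  (forall B (F : ahom T1 (homalg T2 B)),
     postcomp T2 (ouncurry F) f = postcomp T2 (ouncurry F) g) -> f = g.
Proof.
move=> fg; apply: ahom_ext => b; apply: odot_ext => B F.
by have /(congr1 (fun h : ahom T2 B => h b)) := fg B F.
Qed.

Let ogenl (a : T1) : homalg T2 odot_alg := ogenr a.
Fact ogenlD a a' : ogenl (a + a') = ogenl a + ogenl a'.
Proof.
by apply: hom_odot_ext => B F; rewrite rmorphD !postcomp_ogenr rmorphD.
Qed.
Fact ogenlM a a' : ogenl (a * a') = ogenl a * ogenl a'.
Proof.
by apply: hom_odot_ext => B F; rewrite rmorphM !postcomp_ogenr rmorphM.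
Qed.
Fact ogenl_in r : ogenl (calg_in T1 r) = calg_in (homalg T2 odot_alg) r.
Proof.
by apply: hom_odot_ext => B F; rewrite postcomp_ogenr !ahom_in.
Qed.

Definition ouniv : ahom T1 (homalg T2 odot_alg) :=
  @mk_ahom R T1 (homalg T2 odot_alg) ogenl ogenlD ogenlM ogenl_in.

(* Hom(T1 (.) T2, B) = Hom(T1, Hom(T2, B)) *)
Definition ocurry B (h : ahom odot_alg B) : ahom T1 (homalg T2 B) :=
  postcomp T2 h \c ouniv.

Lemma ocurryE B (h : ahom odot_alg B) a b :
  (ocurry h a : ahom T2 B) b = h (ogen a b).
Proof. by []. Qed.

Lemma ouncurryK B : cancel (@ouncurry B) (@ocurry B).
Proof.
by move=> F; apply: ahom_ext => a; apply: ahom_ext => b; rewrite ocurryE ouncurryE.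
Qed.

Lemma ocurryK B : cancel (@ocurry B) (@ouncurry B).
Proof. by move=> h; apply: pres_hom_ext => -[a b]; rewrite ouncurryE. Qed.

Lemma ocurry_inj B (h k : ahom odot_alg B) :
  (forall a b, h (ogen a b) = k (ogen a b)) -> h = k.
Proof. by move=> hk; apply: pres_hom_ext => -[a b]; apply: hk. Qed.

Lemma ocurry_acomp B C (k : ahom B C) (h : ahom odot_alg B) :
  ocurry (k \c h) = postcomp T2 k \c ocurry h.
Proof. by apply: ahom_ext => a; apply: ahom_ext. Qed.

(* The co-operations of T1 (.) T2 make this bijection one of R-algebras, the
   right-hand side being Hom(T1, -) of the R-algebra Hom(T2, B). *)
Let o1 := coalg_ops T1.
Definition odot_ops : co_ops odot_alg := {|
  coadd := ouncurry (hadd o1 (ocurry tinl) (ocurry tinr));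
  coopp := ouncurry (hopp o1 (ocurry (aid odot_alg)));
  comul := ouncurry (hmul o1 (ocurry tinl) (ocurry tinr));
  cocst r := ouncurry (hcst o1 (homalg T2 (base R)) r) |}.

Lemma ocurryD B (h k : ahom odot_alg B) :
  ocurry (hadd odot_ops h k) = hadd o1 (ocurry h) (ocurry k).
Proof.
by rewrite ocurry_acomp ouncurryK acomp_hadd -!ocurry_acomp copair_inl copair_inr.
Qed.
Lemma ocurryM B (h k : ahom odot_alg B) :
  ocurry (hmul odot_ops h k) = hmul o1 (ocurry h) (ocurry k).
Proof.
by rewrite ocurry_acomp ouncurryK acomp_hmul -!ocurry_acomp copair_inl copair_inr.
Qed.
Lemma ocurryN B (h : ahom odot_alg B) :
  ocurry (hopp odot_ops h) = hopp o1 (ocurry h).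
Proof.
rewrite ocurry_acomp ouncurryK acomp_hopp -!ocurry_acomp; congr (hopp o1 (ocurry _)).
exact: ahom_ext.
Qed.
Lemma ocurryC B r : ocurry (hcst odot_ops B r) = hcst o1 (homalg T2 B) r.
Proof. by rewrite ocurry_acomp ouncurryK acomp_hcst. Qed.

Fact odot_laws : co_laws odot_ops.
Proof.
have inj B : injective (@ocurry B) := can_inj (@ocurryK B).
have l := coalg_laws T1.
split=> [B f g h|B f g|B f|B f|B f g h|B f g|B f|B f g h|B r s|B r s];
  apply: inj; rewrite ?(ocurryD, ocurryM, ocurryN, ocurryC).
- exact: haddA.
- exact: haddC.
- exact: hadd0.
- exact: haddN.
- exact: hmulA.
- exact: hmulC.
- exact: hmul1.
- exact: hmulD.
- exact: hcstD.
- exact: hcstM.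
Qed.

Definition odot : coalg R := Coalg odot_laws.

Definition ocurry_hom B : ahom (homalg odot B) (homalg T1 (homalg T2 B)) :=
  @mk_ahom R (homalg odot B) (homalg T1 (homalg T2 B)) (@ocurry B)
    (@ocurryD B) (@ocurryM B) (@ocurryC B).

End Odot.

Section OdotMaps.
Variable R : comNzRingType.

(* f (.) g : t1 (.) t2 |-> f t1 (.) g t2 *)
Definition odot_map (T1 T2 S1 S2 : coalg R) (f : ahom T1 S1) (g : cohom T2 S2) :
    ahom (odot T1 T2) (odot S1 S2) :=
  ouncurry (precomp g (odot S1 S2) \c (ouniv S1 S2 \c f)).

(* (t1 (.) t2) (.) t3 |-> t1 (.) (t2 (.) t3) *)
Definition oassoc (T1 T2 T3 : coalg R) :
    ahom (odot (odot T1 T2) T3) (odot T1 (odot T2 T3)) :=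
  ouncurry (ouncurry (ocurry_hom T2 T3 _ \c ouniv T1 (odot T2 T3))
    : ahom (odot T1 T2) (homalg T3 _)).

Lemma odot_mapE (T1 T2 S1 S2 : coalg R) (f : ahom T1 S1) (g : cohom T2 S2) a b :
  odot_map f g (ogen a b) = ogen (f a) (g b).
Proof. exact: ouncurryE. Qed.

Lemma oassocE (T1 T2 T3 : coalg R) (a : T1) (b : T2) (c : T3) :
  oassoc T1 T2 T3 (ogen (ogen a b : odot T1 T2) c) =
    ogen a (ogen b c : odot T2 T3).
Proof. by rewrite ouncurryE ouncurryE. Qed.

End OdotMaps.

(** * The unit object R[x] *)

Section PolyAlg.
Variable R : comNzRingType.

Definition poly_alg : calg R := @CAlg R {poly R} polyC.

Section Eval.
Variables (B : calg R) (b : B).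

(* the library's [horner] requires a non-trivial ring *)
Definition aeval_fun (p : poly_alg) : B :=
  \sum_(i < size (p : {poly R})) calg_in B (p : {poly R})`_i * b ^+ i.

Lemma aeval_big n (p : poly_alg) : (size (p : {poly R}) <= n)%N ->
  aeval_fun p = \sum_(i < n) calg_in B (p : {poly R})`_i * b ^+ i.
Proof.
move=> le_pn; rewrite /aeval_fun; pose F i := calg_in B (p : {poly R})`_i * b ^+ i.
rewrite -(big_mkord xpredT F) -[RHS](big_mkord xpredT F).
rewrite [RHS](big_cat_nat (n := size (p : {poly R}))) //=.
rewrite [X in _ + X]big_nat_cond [X in _ + X]big1 ?addr0 // => i.
by case/andP=> /andP[le_pi _] _; rewrite /F nth_default // rmorph0 mul0r.
Qed.

Fact aevalD p q : aeval_fun (p + q) = aeval_fun p + aeval_fun q.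
Proof.
pose n := maxn (size (p : {poly R})) (size (q : {poly R})).
rewrite !(@aeval_big n) ?leq_maxl ?leq_maxr ?size_polyD // -big_split /=.
by apply: eq_bigr => i _; rewrite coefD rmorphD mulrDl.
Qed.

Fact aeval_in r : aeval_fun (calg_in poly_alg r) = calg_in B r.
Proof.
by rewrite (@aeval_big 1) ?size_polyC_leq1 // big_ord1 coefC mulr1.
Qed.

Lemma aeval_MX (p : {poly R}) : aeval_fun (p * 'X) = aeval_fun p * b.
Proof.
have le_pX : (size (p * 'X)%R <= (size p).+1)%N.
  by rewrite (leq_trans (size_polyMleq _ _)) // size_polyX addn2.
rewrite (aeval_big le_pX) big_ord_recl /= coefMX rmorph0 mul0r add0r.
rewrite mulr_suml; apply: eq_bigr => i _.
by rewrite coefMX /= -mulrA exprSr.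
Qed.

Lemma aeval_CM r (p : {poly R}) : aeval_fun (r%:P * p) = calg_in B r * aeval_fun p.
Proof.
have le_p : (size (r%:P * p)%R <= size p)%N by rewrite mul_polyC size_scale_leq.
rewrite (aeval_big le_p) mulr_sumr; apply: eq_bigr => i _.
by rewrite coefCM rmorphM mulrA.
Qed.

Fact aevalM p q : aeval_fun (p * q) = aeval_fun p * aeval_fun q.
Proof.
elim/poly_ind: p => [|p r IHp].
  by rewrite mul0r -[0]/(calg_in poly_alg 0) aeval_in rmorph0 mul0r.
rewrite mulrDl aevalD aeval_CM -mulrA (mulrC 'X) mulrA aeval_MX IHp.
by rewrite aevalD aeval_MX -[r%:P]/(calg_in poly_alg r) aeval_in mulrDl mulrAC.
Qed.

Definition aeval : ahom poly_alg B := mk_ahom aevalD aevalM aeval_in.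

Lemma aevalX : aeval 'X = b.
Proof. by rewrite -['X]mul1r rmorphM rmorph1 mul1r /= -['X]mul1r aeval_MX
 -[1]/(calg_in poly_alg 1) aeval_in rmorph1 mul1r. Qed.

End Eval.

Lemma poly_hom_ext (B : calg R) (f g : ahom poly_alg B) : f 'X = g 'X -> f = g.
Proof.
move=> fg; apply: ahom_ext; elim/poly_ind => [|p r IHp]; first by rewrite !rmorph0.
by rewrite !rmorphD !rmorphM IHp fg -[r%:P]/(calg_in poly_alg r) !ahom_in.
Qed.

Let x : poly_alg := 'X.

Definition poly_ops : co_ops poly_alg := {|
  coadd := aeval (tens 1 x + tens x 1);
  coopp := aeval (- x);
  comul := aeval (tens x x);
  cocst r := @aeval (base R) r |}.

Lemma poly_haddX B (f g : ahom poly_alg B) : hadd poly_ops f g 'X = f 'X + g 'X.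
Proof.
rewrite /= -[aeval_fun _ _]/(aeval _ _) aevalX -[LHS]/(copair f g _) rmorphD.
by rewrite !copair_tens !rmorph1 mulr1 mul1r addrC.
Qed.
Lemma poly_hoppX B (f : ahom poly_alg B) : hopp poly_ops f 'X = - f 'X.
Proof. by rewrite /= -[aeval_fun _ _]/(aeval _ _) aevalX rmorphN. Qed.
Lemma poly_hmulX B (f g : ahom poly_alg B) : hmul poly_ops f g 'X = f 'X * g 'X.
Proof.
by rewrite /= -[aeval_fun _ _]/(aeval _ _) aevalX -[LHS]/(copair f g _) copair_tens.
Qed.
Lemma poly_hcstX B r : hcst poly_ops B r 'X = calg_in B r.
Proof. by rewrite /= -[aeval_fun _ _]/(aeval _ _) aevalX. Qed.

Fact poly_laws : co_laws poly_ops.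
Proof.
have E := (poly_haddX, poly_hoppX, poly_hmulX, poly_hcstX).
split=> [B f g h|B f g|B f|B f|B f g h|B f g|B f|B f g h|B r s|B r s];
  apply: poly_hom_ext; rewrite !E.
- exact: addrA.
- exact: addrC.
- by rewrite rmorph0 add0r.
- by rewrite rmorph0 addNr.
- exact: mulrA.
- exact: mulrC.
- by rewrite rmorph1 mul1r.
- exact: mulrDl.
- exact: rmorphD.
- exact: rmorphM.
Qed.

Definition poly_coalg : coalg R := Coalg poly_laws.

Section EvalHom.
Variable B : calg R.
Fact aeval_homD (b c : B) :
  aeval (b + c) = (aeval b : homalg poly_coalg B) + aeval c.
Proof. by apply: poly_hom_ext; rewrite [RHS]poly_haddX !aevalX. Qed.
Fact aeval_homM (b c : B) :
  aeval (b * c) = (aeval b : homalg poly_coalg B) * aeval c.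
Proof. by apply: poly_hom_ext; rewrite [RHS]poly_hmulX !aevalX. Qed.
Fact aeval_hom_in r : aeval (calg_in B r) = calg_in (homalg poly_coalg B) r.
Proof. by apply: poly_hom_ext; rewrite [RHS]poly_hcstX !aevalX. Qed.

(* R[x] represents the identity functor: b |-> (p |-> p(b)) *)
Definition aeval_hom : ahom B (homalg poly_coalg B) :=
  @mk_ahom R B (homalg poly_coalg B) (@aeval B) aeval_homD aeval_homM aeval_hom_in.

End EvalHom.

End PolyAlg.

Section Unitors.
Variables (R : comNzRingType) (T : coalg R).
Local Notation I := (poly_coalg R).

(* x (.) t |-> t and t (.) x |-> t *)
Definition ounitl : ahom (odot I T) T :=
  @ouncurry R I T T (@aeval R (homalg T T) (aid T)).
Definition ounitr : ahom (odot T I) T := @ouncurry R T I T (aeval_hom T).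

Lemma ounitlE t : ounitl (ogen ('X : I) t) = t.
Proof. by rewrite ouncurryE aevalX. Qed.
Lemma ounitrE t : ounitr (ogen t ('X : I)) = t.
Proof. by rewrite ouncurryE [LHS]aevalX. Qed.

End Unitors.

(** * Tall-Wraith monoids *)

Record tw_monoid (R : comNzRingType) := TWMonoid {
  tw_coalg :> coalg R;
  tw_mul : cohom (odot tw_coalg tw_coalg) tw_coalg;
  tw_unit : cohom (poly_coalg R) tw_coalg;
  tw_assoc : tw_mul \c odot_map tw_mul (cohom_id tw_coalg) =
    tw_mul \c odot_map (aid tw_coalg) tw_mul \c oassoc tw_coalg tw_coalg tw_coalg;
  tw_unitl : tw_mul \c odot_map tw_unit (cohom_id tw_coalg) = ounitl tw_coalg;
  tw_unitr : tw_mul \c odot_map (aid tw_coalg) tw_unit = ounitr tw_coalg }.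

Record tw_hom (R : comNzRingType) (T S : tw_monoid R) := TWHom {
  tw_cohom :> cohom T S;
  tw_hom_mul : tw_cohom \c tw_mul T = tw_mul S \c odot_map tw_cohom tw_cohom;
  tw_hom_unit : tw_cohom \c tw_unit T = tw_unit S }.

(* A co-B-algebra object T generated by an element x on which the co-operations
   are those of R[x] is a Tall-Wraith monoid as soon as x (.) t |-> t extends
   to a homomorphism. *)
Section Monogenic.
Variables (R : comNzRingType) (T : coalg R) (x : T).
Let o := coalg_ops T.
Local Notation I := (poly_coalg R).
Hypothesis x_ext : forall (B : calg R) (f g : ahom T B), f x = g x -> f = g.
Hypothesis xD : forall B (f g : ahom T B), hadd o f g x = f x + g x.
Hypothesis xN : forall B (f : ahom T B), hopp o f x = - f x.
Hypothesis xM : forall B (f g : ahom T B), hmul o f g x = f x * g x.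
Hypothesis xC : forall B r, hcst o B r x = calg_in B r.
Variable K : ahom T (homalg T T).
Hypothesis Kx : (K x : ahom T T) = aid T.

Let mul : ahom (odot T T) T := ouncurry K.

Let mulx t : mul (ogen x t) = t.
Proof. by rewrite ouncurryE Kx. Qed.

Let mulx_curry B (f : ahom T B) :
  (ocurry (f \c mul : ahom (odot_alg T T) B) x : ahom T B) = f.
Proof. by apply: ahom_ext => t; rewrite ocurryE -[RHS](congr1 f (mulx t)). Qed.

Fact mono_mulD B (u v : ahom T B) :
  hadd o u v \c mul = hadd (odot_ops T T) (u \c mul) (v \c mul).
Proof.
apply: (can_inj (@ocurryK _ _ _ _)); rewrite ocurryD; apply: x_ext.
by rewrite xD [LHS]mulx_curry [X in X + _]mulx_curry [X in _ + X]mulx_curry.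
Qed.
Fact mono_mulM B (u v : ahom T B) :
  hmul o u v \c mul = hmul (odot_ops T T) (u \c mul) (v \c mul).
Proof.
apply: (can_inj (@ocurryK _ _ _ _)); rewrite ocurryM; apply: x_ext.
by rewrite xM [LHS]mulx_curry [X in X * _]mulx_curry [X in _ * X]mulx_curry.
Qed.
Fact mono_mulN B (u : ahom T B) :
  hopp o u \c mul = hopp (odot_ops T T) (u \c mul).
Proof.
apply: (can_inj (@ocurryK _ _ _ _)); rewrite ocurryN; apply: x_ext.
by rewrite xN [LHS]mulx_curry [X in - X]mulx_curry.
Qed.
Fact mono_mulC B r : hcst o B r \c mul = hcst (odot_ops T T) B r.
Proof.
apply: (can_inj (@ocurryK _ _ _ _)); rewrite ocurryC; apply: x_ext.
by rewrite xC [LHS]mulx_curry.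
Qed.

Definition mono_mul : cohom (odot T T) T :=
  @mk_cohom R (odot T T) T mul mono_mulD mono_mulN mono_mulM mono_mulC.

Let unit : ahom I T := aeval x.

Let unitX : unit 'X = x. Proof. exact: aevalX. Qed.

Fact mono_unitD B (u v : ahom T B) :
  hadd o u v \c unit = hadd (poly_ops R) (u \c unit) (v \c unit).
Proof.
by apply: poly_hom_ext; rewrite poly_haddX -![(_ \c unit) _]/(_ (unit 'X)) unitX xD.
Qed.
Fact mono_unitM B (u v : ahom T B) :
  hmul o u v \c unit = hmul (poly_ops R) (u \c unit) (v \c unit).
Proof.
by apply: poly_hom_ext; rewrite poly_hmulX -![(_ \c unit) _]/(_ (unit 'X)) unitX xM.
Qed.
Fact mono_unitN B (u : ahom T B) :
  hopp o u \c unit = hopp (poly_ops R) (u \c unit).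
Proof.
by apply: poly_hom_ext; rewrite poly_hoppX -![(_ \c unit) _]/(_ (unit 'X)) unitX xN.
Qed.
Fact mono_unitC B r : hcst o B r \c unit = hcst (poly_ops R) B r.
Proof.
by apply: poly_hom_ext; rewrite poly_hcstX -![(_ \c unit) _]/(_ (unit 'X)) unitX xC.
Qed.

Definition mono_unit : cohom I T :=
  @mk_cohom R I T unit mono_unitD mono_unitN mono_unitM mono_unitC.

Fact mono_assoc : mono_mul \c odot_map mono_mul (cohom_id T) =
  mono_mul \c odot_map (aid T) mono_mul \c oassoc T T T.
Proof.
apply: (can_inj (@ocurryK _ _ _ _)); apply: (can_inj (@ocurryK _ _ _ _)).
apply: x_ext; apply: ahom_ext => b; apply: ahom_ext => c.
rewrite !ocurryE -[LHS]/(mul (odot_map mono_mul (cohom_id T) _)) odot_mapE.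
rewrite -[RHS]/(mul (odot_map (aid T) mono_mul (oassoc T T T _))) oassocE odot_mapE.
rewrite -[aid T x]/x mulx.
by rewrite -[cohom_id T c]/c -[mono_mul (ogen x b)]/(mul (ogen x b)) mulx.
Qed.

Fact mono_unitl : mono_mul \c odot_map mono_unit (cohom_id T) = ounitl T.
Proof.
apply: (can_inj (@ocurryK _ _ _ _)); apply: poly_hom_ext; apply: ahom_ext => t.
rewrite !ocurryE ounitlE -[LHS]/(mul (odot_map mono_unit (cohom_id T) _)) odot_mapE.
by rewrite -[mono_unit 'X]/(unit 'X) unitX mulx.
Qed.

Fact mono_unitr : mono_mul \c odot_map (aid T) mono_unit = ounitr T.
Proof.
apply: (can_inj (@ocurryK _ _ _ _)); apply: x_ext; apply: poly_hom_ext.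
rewrite !ocurryE ounitrE -[LHS]/(mul (odot_map (aid T) mono_unit _)) odot_mapE.
by rewrite -[mono_unit 'X]/(unit 'X) unitX mulx.
Qed.

Definition mono_tw : tw_monoid R := TWMonoid mono_assoc mono_unitl mono_unitr.

End Monogenic.

(** * The Tall-Wraith monoid R[x] *)

Section PolyTW.
Variable R : comNzRingType.
Local Notation I := (poly_coalg R).

Fact aeval_homX : (aeval_hom I 'X : ahom I I) = aid I.
Proof. by apply: poly_hom_ext; rewrite [LHS]aevalX. Qed.

Definition poly_tw : tw_monoid R :=
  mono_tw (T := I) (@poly_hom_ext R) (@poly_haddX R) (@poly_hoppX R) (@poly_hmulX R)
    (@poly_hcstX R) aeval_homX.

Lemma aeval_comp (p q : {poly R}) : @aeval R I p q = q \Po p.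
Proof.
elim/poly_ind: q => [|q r IHq]; first by rewrite rmorph0 comp_poly0.
rewrite comp_polyD comp_polyM comp_polyX comp_polyC -IHq.
by rewrite rmorphD rmorphM aevalX -[r%:P]/(calg_in (poly_alg R) r) ahom_in.
Qed.

(* As p (.) q is homomorphic in q, the composite is q o p. *)
Lemma poly_tw_mulE (p q : I) :
  tw_mul poly_tw (ogen p q) = (q : {poly R}) \Po (p : {poly R}).
Proof. by rewrite -aeval_comp; apply: ouncurryE. Qed.

Lemma poly_tw_unitE (p : I) : tw_unit poly_tw p = p.
Proof. by rewrite -[LHS]/(@aeval R I 'X p) aeval_comp comp_polyXr. Qed.

End PolyTW.

(** * The quotient of R[x] by x^(p^n) - x *)

Section Quotient.
Import Pdiv.CommonRing Pdiv.RingMonic.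
Variables (R : finFieldType) (p n : nat).
Hypothesis charR : p \in [pchar R].
Hypothesis cardR : #|R| = (p ^ n)%N.
Local Notation q := (p ^ n)%N.
Local Notation h := ('X^q - 'X : {poly R}).
Local Notation I := (poly_coalg R).

(* h is monic of positive degree, so that {poly %/ h} is the quotient by h. *)
Fact quot_size : size h = q.+1.
Proof.
have q_gt1 : (1 < q)%N by rewrite -cardR finNzRing_gt1.
by rewrite size_polyDl size_polyXn // size_polyN size_polyX.
Qed.

Fact quot_monic : mk_monic h = h.
Proof.
have q_gt1 : (1 < q)%N by rewrite -cardR finNzRing_gt1.
rewrite /mk_monic quot_size ltnS (ltnW q_gt1) /= monicE lead_coefDl.
  by rewrite lead_coefXn eqxx.
by rewrite size_polyXn // size_polyN size_polyX.
Qed.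

Definition quot_alg : calg R := @CAlg R {poly %/ h} (qpolyC h).

Fact quot_proj_in r : in_qpoly h (calg_in (poly_alg R) r) = calg_in quot_alg r.
Proof.
by apply: val_inj; apply: in_qpoly_small; apply: (size_mk_monic (qpolyC h r)).
Qed.
Definition quot_proj : ahom (poly_alg R) quot_alg :=
  @AHom R (poly_alg R) quot_alg (in_qpoly h) quot_proj_in.

Lemma quot_projK (u : quot_alg) : quot_proj (u : {poly %/ h}) = u.
Proof. by apply: val_inj; apply: in_qpoly_small; apply: size_mk_monic. Qed.

Section Lift.
Variables (B : calg R) (f : ahom (poly_alg R) B).
Hypothesis fq : f 'X ^+ q = f 'X.

Lemma quot_kill (u : {poly R}) : f (rmodp u (mk_monic h)) = f u.
Proof.
rewrite [in RHS](rdivp_eq (monic_mk_monic h) u) rmorphD rmorphM quot_monic.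
by rewrite [X in _ * X]rmorphB rmorphXn fq subrr mulr0 add0r.
Qed.

Definition qlift_fun (u : quot_alg) : B := f ((u : {poly %/ h}) : {poly R}).
Fact qliftD u v : qlift_fun (u + v) = qlift_fun u + qlift_fun v.
Proof.
exact: (rmorphD f (polyn (u : {poly %/ h})) (polyn (v : {poly %/ h}))).
Qed.
Fact qliftM u v : qlift_fun (u * v) = qlift_fun u * qlift_fun v.
Proof. by rewrite /qlift_fun quot_kill rmorphM. Qed.
Fact qlift_in r : qlift_fun (calg_in quot_alg r) = calg_in B r.
Proof. by rewrite -(ahom_in f). Qed.

(* the homomorphism induced by f on the quotient *)
Definition qlift : ahom quot_alg B := mk_ahom qliftD qliftM qlift_in.

Lemma qlift_proj : qlift \c quot_proj = f.
Proof. by apply: ahom_ext => u; apply: quot_kill. Qed.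

End Lift.

Let x : quot_alg := quot_proj 'X.

Lemma quot_hom_ext (B : calg R) (f g : ahom quot_alg B) : f x = g x -> f = g.
Proof.
move=> fg; have e : f \c quot_proj = g \c quot_proj by apply: poly_hom_ext.
apply: ahom_ext => u; rewrite -(quot_projK u).
by have /(congr1 (fun k : ahom (poly_alg R) B => k u)) := e.
Qed.

Lemma qliftX B (f : ahom (poly_alg R) B) (fq : f 'X ^+ q = f 'X) :
  qlift fq x = f 'X.
Proof. by rewrite -[in RHS](qlift_proj fq). Qed.

Section Frobenius.
Variable B : calg R.

Fact calg_exprD (a b : B) : (a + b) ^+ q = a ^+ q + b ^+ q.
Proof.
have pB : p%:R = 0 :> B.
  by rewrite -(rmorph_nat (calg_in B)) (pcharf0 charR) rmorph0.
have pr := pcharf_prime charR.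
have Fr (c d : B) : (c + d) ^+ p = c ^+ p + d ^+ p.
  rewrite exprDn -(prednK (prime_gt0 pr)) big_ord_recr big_ord_recl /=.
  rewrite (prednK (prime_gt0 pr)) subn0 subnn !expr0 mulr1 mul1r bin0 binn !mulr1n.
  rewrite big1 ?addr0 // => i _; rewrite -mulr_natr.
  have /dvdnP[k ->] : (p %| 'C(p, bump 0 i))%N.
    rewrite prime_dvd_bin // /bump leq0n add1n /=.
    by rewrite -[X in (_ < X)%N](prednK (prime_gt0 pr)) ltnS ltn_ord.
  by rewrite natrM pB !mulr0.
elim: (n) => [|m IHm]; first by rewrite expn0 !expr1.
by rewrite expnSr !exprM IHm Fr.
Qed.

Fact calg_exprC r : calg_in B r ^+ q = calg_in B r.
Proof. by rewrite -rmorphXn -cardR expf_card. Qed.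

Fact calg_exprN (a : B) : (- a) ^+ q = - a ^+ q.
Proof.
have := calg_exprC (-1); rewrite rmorphN1 => e.
by rewrite -mulN1r exprMn e mulN1r.
Qed.

End Frobenius.

Fact x_expr : x ^+ q = x.
Proof.
have h0 : quot_proj h = 0.
  by apply: val_inj; rewrite /= quot_monic rmodpp // -quot_monic monic_mk_monic.
by apply/eqP; rewrite -subr_eq0 -rmorphXn -rmorphB h0.
Qed.

(* The co-operations induced by those of R[x]; they are well defined, because
   the value y of (proj (x) proj) o Delta at x satisfies y ^ (p^n) = y. *)

Let xl : (tinl x : tensor quot_alg quot_alg) ^+ q = tinl x.
Proof. by rewrite -rmorphXn x_expr. Qed.
Let xr : (tinr x : tensor quot_alg quot_alg) ^+ q = tinr x.
Proof. by rewrite -rmorphXn x_expr. Qed.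

Fact quot_addP : (tmap quot_proj quot_proj \c coadd (poly_ops R)) 'X ^+ q =
  (tmap quot_proj quot_proj \c coadd (poly_ops R)) 'X.
Proof.
by rewrite poly_haddX calg_exprD; congr (_ + _); [exact: xl | exact: xr].
Qed.
Fact quot_oppP : (quot_proj \c coopp (poly_ops R)) 'X ^+ q =
  (quot_proj \c coopp (poly_ops R)) 'X.
Proof. by rewrite poly_hoppX calg_exprN x_expr. Qed.
Fact quot_mulP : (tmap quot_proj quot_proj \c comul (poly_ops R)) 'X ^+ q =
  (tmap quot_proj quot_proj \c comul (poly_ops R)) 'X.
Proof.
by rewrite poly_hmulX exprMn; congr (_ * _); [exact: xl | exact: xr].
Qed.
Fact quot_cstP r : cocst (poly_ops R) r 'X ^+ q = cocst (poly_ops R) r 'X.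
Proof. by rewrite aevalX; apply: (calg_exprC (base R)). Qed.

Definition quot_ops : co_ops quot_alg := {|
  coadd := qlift quot_addP;
  coopp := qlift quot_oppP;
  comul := qlift quot_mulP;
  cocst r := qlift (quot_cstP r) |}.

Lemma quot_haddX B (f g : ahom quot_alg B) : hadd quot_ops f g x = f x + g x.
Proof.
rewrite -[LHS]/(copair f g (qlift quot_addP x)) qliftX.
rewrite -[LHS]/((copair f g \c (tmap quot_proj quot_proj)) (coadd (poly_ops R) 'X)).
by rewrite copair_tmap [LHS]poly_haddX.
Qed.
Lemma quot_hoppX B (f : ahom quot_alg B) : hopp quot_ops f x = - f x.
Proof.
by rewrite -[LHS]/(f (qlift quot_oppP x)) qliftX poly_hoppX rmorphN.
Qed.
Lemma quot_hmulX B (f g : ahom quot_alg B) : hmul quot_ops f g x = f x * g x.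
Proof.
rewrite -[LHS]/(copair f g (qlift quot_mulP x)) qliftX.
rewrite -[LHS]/((copair f g \c (tmap quot_proj quot_proj)) (comul (poly_ops R) 'X)).
by rewrite copair_tmap [LHS]poly_hmulX.
Qed.
Lemma quot_hcstX B r : hcst quot_ops B r x = calg_in B r.
Proof.
by rewrite -[LHS]/(ainit B (qlift (quot_cstP r) x)) qliftX aevalX.
Qed.

Fact quot_laws : co_laws quot_ops.
Proof.
have E := (quot_haddX, quot_hoppX, quot_hmulX, quot_hcstX).
split=> [B f g k|B f g|B f|B f|B f g k|B f g|B f|B f g k|B r s|B r s];
  apply: quot_hom_ext; rewrite !E.
- exact: addrA.
- exact: addrC.
- by rewrite rmorph0 add0r.
- by rewrite rmorph0 addNr.
- exact: mulrA.
- exact: mulrC.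
- by rewrite rmorph1 mul1r.
- exact: mulrDl.
- exact: rmorphD.
- exact: rmorphM.
Qed.

Definition quot_coalg : coalg R := Coalg quot_laws.
Local Notation Q := quot_coalg.

Fact quot_homX m B (f : homalg Q B) :
  ((f ^+ m : homalg Q B) : ahom Q B) x = (f : ahom Q B) x ^+ m.
Proof.
elim: m => [|m IHm]; first by rewrite [LHS]quot_hcstX rmorph1.
by rewrite !exprS [LHS]quot_hmulX IHm.
Qed.

(* The class of p is sent to the endomorphism t |-> t o p of the quotient; this
   is determined by x |-> id. *)
Fact quot_curryP : @aeval R (homalg Q Q) (aid Q) 'X ^+ q =
  @aeval R (homalg Q Q) (aid Q) 'X.
Proof. by rewrite aevalX; apply: quot_hom_ext; rewrite quot_homX x_expr. Qed.
Definition quot_curry : ahom Q (homalg Q Q) := qlift quot_curryP.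

Fact quot_curryX : (quot_curry x : ahom Q Q) = aid Q.
Proof. by rewrite [LHS]qliftX aevalX. Qed.

Definition quot_tw : tw_monoid R :=
  mono_tw (T := Q) quot_hom_ext quot_haddX quot_hoppX quot_hmulX quot_hcstX
    quot_curryX.

(* the structure is the one inherited from R[x] *)
Definition quot_proj_tw : tw_hom (poly_tw R) quot_tw.
Proof.
have projD B (u v : ahom Q B) : hadd quot_ops u v \c quot_proj =
    hadd (poly_ops R) (u \c quot_proj) (v \c quot_proj).
  by apply: poly_hom_ext; rewrite poly_haddX [LHS]quot_haddX.
have projN B (u : ahom Q B) : hopp quot_ops u \c quot_proj =
    hopp (poly_ops R) (u \c quot_proj).
  by apply: poly_hom_ext; rewrite poly_hoppX [LHS]quot_hoppX.
have projM B (u v : ahom Q B) : hmul quot_ops u v \c quot_proj =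
    hmul (poly_ops R) (u \c quot_proj) (v \c quot_proj).
  by apply: poly_hom_ext; rewrite poly_hmulX [LHS]quot_hmulX.
have projC B r : hcst quot_ops B r \c quot_proj = hcst (poly_ops R) B r.
  by apply: poly_hom_ext; rewrite poly_hcstX [LHS]quot_hcstX.
pose pr : cohom (poly_tw R) quot_tw :=
  @mk_cohom R I Q quot_proj projD projN projM projC.
apply: (@TWHom R (poly_tw R) quot_tw pr).
- apply: (can_inj (@ocurryK _ _ _ _)).
  apply: poly_hom_ext; apply: poly_hom_ext; rewrite !ocurryE.
  rewrite -[LHS]/(quot_proj (tw_mul (poly_tw R) _)).
  rewrite -[RHS]/(tw_mul quot_tw (odot_map pr pr _)) odot_mapE poly_tw_mulE comp_polyX.
  by rewrite [RHS]ouncurryE -[pr 'X]/x quot_curryX.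
- apply: poly_hom_ext; rewrite -[LHS]/(quot_proj (tw_unit (poly_tw R) 'X)).
  by rewrite poly_tw_unitE [RHS]aevalX.
Defined.

End Quotient.

(** * The Tall-Wraith monoid Hom_Set(|R|, |R|) *)

Section FunctionAlgebra.
Variable R : finFieldType.

Section Functions.
Variable X : Type.
Definition fct_cst (r : R) : X -> R := cst r.
Fact fct_cst_nmod : nmod_morphism fct_cst.
Proof. by split. Qed.
Fact fct_cst_monoid : monoid_morphism fct_cst.
Proof. by split. Qed.
HB.instance Definition _ := GRing.isNmodMorphism.Build R (X -> R)
  fct_cst fct_cst_nmod.
HB.instance Definition _ := GRing.isMonoidMorphism.Build R (X -> R)
  fct_cst fct_cst_monoid.

Definition fct_alg : calg R := @CAlg R (X -> R) fct_cst.
End Functions.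

(* precomposition with u *)
Definition pre (X Y : Type) (u : X -> Y) : ahom (fct_alg Y) (fct_alg X) :=
  @mk_ahom R (fct_alg Y) (fct_alg X) (fun (f : Y -> R) => f \o u)
    (fun _ _ => erefl) (fun _ _ => erefl) (fun _ => erefl).

Definition evalat (X : Type) (a : X) : ahom (fct_alg X) (base R) :=
  @mk_ahom R (fct_alg X) (base R) (fun f : X -> R => f a)
    (fun _ _ => erefl) (fun _ _ => erefl) (fun _ => erefl).

Definition delta (X : finType) (a : X) : fct_alg X := fun b => (b == a)%:R.

Section Idempotents.
Variables (Z : finType) (B : calg R) (e : Z -> B).
Hypothesis e_orth : forall z w, e z * e w = (z == w)%:R * e z.
Hypothesis e_sum : \sum_z e z = 1.

Definition idem_fun (f : fct_alg Z) : B := \sum_z calg_in B (f z) * e z.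
Fact idemD f g : idem_fun (f + g) = idem_fun f + idem_fun g.
Proof.
by rewrite -big_split; apply: eq_bigr => z _ /=; rewrite -mulrDl -rmorphD.
Qed.
Fact idemM f g : idem_fun (f * g) = idem_fun f * idem_fun g.
Proof.
rewrite /idem_fun [RHS]mulr_suml; apply: eq_bigr => z _; rewrite mulr_sumr (bigD1 z) //=.
rewrite big1 ?addr0 => [|w /negPf w_z].
  by rewrite mulrACA e_orth eqxx mul1r -rmorphM.
by rewrite mulrACA e_orth eq_sym w_z mul0r mulr0.
Qed.
Fact idem_in r : idem_fun (calg_in (fct_alg Z) r) = calg_in B r.
Proof. by rewrite -[RHS]mulr1 -e_sum mulr_sumr; apply: eq_bigr. Qed.
Definition idem_hom : ahom (fct_alg Z) B := mk_ahom idemD idemM idem_in.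
End Idempotents.

Lemma delta_orth (X : finType) (a b : X) :
  delta a * delta b = (a == b)%:R * delta a.
Proof.
apply: funext => c; rewrite -[LHS]/(delta a c * delta b c).
have [<-|ab] := eqVneq a b.
  by rewrite mul1r /delta -natrM mulnb andbb.
rewrite mul0r /delta -natrM mulnb; case: eqVneq => //= ->.
by rewrite (negPf ab).
Qed.

Lemma delta_decomp (X : finType) (f : fct_alg X) :
  f = \sum_a calg_in (fct_alg X) (f a) * delta a.
Proof.
apply: funext => b; rewrite fct_sumE (bigD1 b) //= big1 ?addr0 => [|a /negPf ab].
  by rewrite -[RHS]/(f b * delta b b) /delta eqxx mulr1.
by rewrite -[LHS]/(f a * delta a b) /delta eq_sym ab mulr0.
Qed.

Section Square.
Variables X Y : finType.
Local Notation T := (tensor (fct_alg X) (fct_alg Y)).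

(* f (x) g |-> ((a, b) |-> f a * g b) *)
Definition fct_tensor : ahom T (fct_alg (X * Y)) :=
  copair (pre fst) (pre snd).

Let e (z : X * Y) : T := tens (delta z.1) (delta z.2).

Fact tens_delta_orth z w : e z * e w = (z == w)%:R * e z.
Proof.
rewrite /e /tens mulrACA -!rmorphM !delta_orth !rmorphM !rmorph_nat.
by rewrite mulrACA -natrM mulnb.
Qed.

Lemma tens_decomp (f : fct_alg X) (g : fct_alg Y) :
  \sum_z calg_in T (f z.1 * g z.2) * e z = tens f g.
Proof.
rewrite /tens [in RHS](delta_decomp f) [in RHS](delta_decomp g) !rmorph_sum.
rewrite mulr_suml -(pair_bigA _ (fun a b => calg_in T (f a * g b) * e (a, b))).
apply: eq_bigr => a _; rewrite mulr_sumr; apply: eq_bigr => b _.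
by rewrite !rmorphM !ahom_in /e /tens mulrACA.
Qed.

Fact tens_delta_sum : \sum_z e z = 1.
Proof.
have := tens_decomp 1 1; rewrite /tens !rmorph1 mulr1 => <-.
by apply: eq_bigr => z _; rewrite -[X in X * _]/(calg_in T (1 * 1)) mulr1 rmorph1 mul1r.
Qed.

Definition fct_tensor_inv : ahom (fct_alg (X * Y)) T :=
  idem_hom tens_delta_orth tens_delta_sum.

Lemma fct_tensorK : fct_tensor_inv \c fct_tensor = aid T.
Proof.
rewrite -(copair_id (fct_alg X) (fct_alg Y)).
apply: copair_uniq; rewrite -acompA ?copair_inl ?copair_inr; apply: ahom_ext => f.
  rewrite -[RHS]mulr1 -(rmorph1 tinr) -[RHS]/(tens f 1) -tens_decomp.
  by apply: eq_bigr => z _; rewrite mulr1.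
rewrite -[RHS]mul1r -(rmorph1 tinl) -[RHS]/(tens 1 f) -tens_decomp.
by apply: eq_bigr => z _; rewrite mul1r.
Qed.

Lemma fct_tensor_invK : fct_tensor \c fct_tensor_inv = aid (fct_alg (X * Y)).
Proof.
apply: ahom_ext => f; rewrite [RHS]/= [RHS]delta_decomp.
rewrite -[LHS]/(fct_tensor (\sum_z _)) rmorph_sum; apply: eq_bigr => z _.
rewrite rmorphM ahom_in copair_tens; congr (_ * _); apply: funext => w.
rewrite -[LHS]/(delta z.1 w.1 * delta z.2 w.2) /delta -natrM mulnb.
by case: z w => [a b] [c d].
Qed.

Variable B : calg R.

Definition fct_pair (f : ahom (fct_alg X) B) (g : ahom (fct_alg Y) B) :
  ahom (fct_alg (X * Y)) B := copair f g \c fct_tensor_inv.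

Lemma fct_pair_uniq f g (k : ahom (fct_alg (X * Y)) B) :
  k \c pre fst = f -> k \c pre snd = g -> fct_pair f g = k.
Proof.
move=> <- <-; rewrite /fct_pair -acomp_copair -acompA fct_tensor_invK.
exact: ahom_ext.
Qed.

Lemma fct_pair_fst f g : fct_pair f g \c pre fst = f.
Proof.
have <- : fct_tensor \c tinl = pre fst by apply: copair_inl.
rewrite /fct_pair acompA -(acompA (copair f g)) fct_tensorK -[RHS](copair_inl f g).
exact: ahom_ext.
Qed.
Lemma fct_pair_snd f g : fct_pair f g \c pre snd = g.
Proof.
have <- : fct_tensor \c tinr = pre snd by apply: copair_inr.
rewrite /fct_pair acompA -(acompA (copair f g)) fct_tensorK -[RHS](copair_inr f g).
exact: ahom_ext.
Qed.

End Square.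

Local Notation F := (fct_alg R).

(* The co-operation of an operation w is precomposition with w, through the
   isomorphism Hom(|R|, R) (x) Hom(|R|, R) = Hom(|R|^2, R). *)
Definition fct_ops : co_ops F := {|
  coadd := fct_tensor_inv R R \c pre (fun z : R * R => z.1 + z.2);
  coopp := pre (fun r : R => - r);
  comul := fct_tensor_inv R R \c pre (fun z : R * R => z.1 * z.2);
  cocst r := evalat r |}.

Section Ops.
Variables (X : Type) (B : calg R) (k : ahom (fct_alg X) B).

Lemma fct_haddE (u v : X -> R) :
  hadd fct_ops (k \c pre u) (k \c pre v) = k \c pre (u + v).
Proof.
rewrite /hadd acompA -/(fct_pair _ _).
rewrite (@fct_pair_uniq _ _ _ _ _ (k \c pre (fun a => (u a, v a)))) //;
  exact: ahom_ext.
Qed.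
Lemma fct_hmulE (u v : X -> R) :
  hmul fct_ops (k \c pre u) (k \c pre v) = k \c pre (u * v).
Proof.
rewrite /hmul acompA -/(fct_pair _ _).
rewrite (@fct_pair_uniq _ _ _ _ _ (k \c pre (fun a => (u a, v a)))) //;
  exact: ahom_ext.
Qed.
Lemma fct_hoppE (u : X -> R) : hopp fct_ops (k \c pre u) = k \c pre (- u).
Proof. exact: ahom_ext. Qed.
Lemma fct_hcstE r : hcst fct_ops B r = k \c pre (cst r : X -> R).
Proof. by apply: ahom_ext => f /=; rewrite -(ahom_in k). Qed.

End Ops.

Lemma fct_triple (B : calg R) (f g h : ahom F B) :
  exists (k : ahom (fct_alg (R * R * R)) B) (u v w : R * R * R -> R),
    [/\ f = k \c pre u, g = k \c pre v & h = k \c pre w].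
Proof.
exists (fct_pair (fct_pair f g) h), (fun z => z.1.1), (fun z => z.1.2), snd.
split; last by rewrite fct_pair_snd.
- by rewrite -[LHS](fct_pair_fst f g) -[X in X \c _](fct_pair_fst _ h);
    apply: ahom_ext.
- by rewrite -[LHS](fct_pair_snd f g) -[X in X \c _](fct_pair_fst _ h);
    apply: ahom_ext.
Qed.

Fact fct_laws : co_laws fct_ops.
Proof.
split=> [B f g h|B f g|B f|B f|B f g h|B f g|B f|B f g h|B r s|B r s].
- have [k [u [v [w [-> -> ->]]]]] := fct_triple f g h.
  by rewrite !fct_haddE addrA.
- have [k [u [v [w [-> -> _]]]]] := fct_triple f g g.
  by rewrite !fct_haddE addrC.
- have [k [u [v [w [-> _ _]]]]] := fct_triple f f f.
  by rewrite (fct_hcstE k) fct_haddE add0r.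
- have [k [u [v [w [-> _ _]]]]] := fct_triple f f f.
  by rewrite (fct_hcstE k) fct_hoppE fct_haddE addNr.
- have [k [u [v [w [-> -> ->]]]]] := fct_triple f g h.
  by rewrite !fct_hmulE mulrA.
- have [k [u [v [w [-> -> _]]]]] := fct_triple f g g.
  by rewrite !fct_hmulE mulrC.
- have [k [u [v [w [-> _ _]]]]] := fct_triple f f f.
  by rewrite (fct_hcstE k) fct_hmulE mul1r.
- have [k [u [v [w [-> -> ->]]]]] := fct_triple f g h.
  by rewrite !(fct_haddE, fct_hmulE) mulrDl.
- by rewrite !(fct_hcstE (ainit B \c evalat (0 : R))) fct_haddE.
- by rewrite !(fct_hcstE (ainit B \c evalat (0 : R))) fct_hmulE.
Qed.

Definition fct_coalg : coalg R := Coalg fct_laws.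
Local Notation FC := fct_coalg.

(* u |-> (f |-> k (f o u)) *)
Section Curry.
Variables (X : Type) (B : calg R) (k : ahom (fct_alg X) B).
Fact fct_curryD (u v : fct_alg X) :
  k \c pre (u + v) = (k \c pre u : homalg FC B) + (k \c pre v : homalg FC B).
Proof. by rewrite [RHS]fct_haddE. Qed.
Fact fct_curryM (u v : fct_alg X) :
  k \c pre (u * v) = (k \c pre u : homalg FC B) * (k \c pre v : homalg FC B).
Proof. by rewrite [RHS]fct_hmulE. Qed.
Fact fct_curry_in r :
  k \c pre (calg_in (fct_alg X) r) = calg_in (homalg FC B) r.
Proof. by rewrite [RHS](fct_hcstE k). Qed.
Definition fct_curry : ahom (fct_alg X) (homalg FC B) :=
  @mk_ahom R (fct_alg X) (homalg FC B) (fun u => k \c pre u)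
    fct_curryD fct_curryM fct_curry_in.
End Curry.

(* f (.) g |-> g o f *)
Definition fct_mul_alg : ahom (odot FC FC) FC :=
  @ouncurry R FC FC FC (fct_curry (aid F)).

Lemma fct_mulE (f g : FC) :
  fct_mul_alg (ogen f g) = (g : R -> R) \o (f : R -> R).
Proof. exact: ouncurryE. Qed.

Let mul_curry B (u : ahom F B) :
  ocurry (u \c fct_mul_alg : ahom (odot_alg FC FC) B) = fct_curry u.
Proof.
apply: ahom_ext => f; apply: ahom_ext => g; rewrite ocurryE.
by rewrite -[RHS](congr1 u (fct_mulE f g)).
Qed.

Let curry_pre B X Y (k : ahom (fct_alg Y) B) (u : Y -> X) :
  fct_curry (k \c pre u) = fct_curry k \c pre u.
Proof. by apply: ahom_ext => f; apply: ahom_ext. Qed.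

Fact fct_mulD B (u v : ahom F B) : hadd fct_ops u v \c fct_mul_alg =
  hadd (odot_ops FC FC) (u \c fct_mul_alg) (v \c fct_mul_alg).
Proof.
apply: (can_inj (@ocurryK _ _ _ _)); rewrite ocurryD !mul_curry.
have [k [a [b [c [-> -> _]]]]] := fct_triple u v v.
by rewrite fct_haddE !curry_pre fct_haddE.
Qed.
Fact fct_mulM B (u v : ahom F B) : hmul fct_ops u v \c fct_mul_alg =
  hmul (odot_ops FC FC) (u \c fct_mul_alg) (v \c fct_mul_alg).
Proof.
apply: (can_inj (@ocurryK _ _ _ _)); rewrite ocurryM !mul_curry.
have [k [a [b [c [-> -> _]]]]] := fct_triple u v v.
by rewrite fct_hmulE !curry_pre fct_hmulE.
Qed.
Fact fct_mulN B (u : ahom F B) : hopp fct_ops u \c fct_mul_alg =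
  hopp (odot_ops FC FC) (u \c fct_mul_alg).
Proof.
apply: (can_inj (@ocurryK _ _ _ _)); rewrite ocurryN !mul_curry.
exact: curry_pre.
Qed.
Fact fct_mulC B r : hcst fct_ops B r \c fct_mul_alg =
  hcst (odot_ops FC FC) B r.
Proof.
apply: (can_inj (@ocurryK _ _ _ _)); rewrite ocurryC mul_curry.
pose k := ainit B \c evalat (0 : R).
by rewrite (fct_hcstE k) curry_pre [RHS](fct_hcstE (fct_curry k)).
Qed.

Definition fct_mul : cohom (odot FC FC) FC :=
  @mk_cohom R (odot FC FC) FC fct_mul_alg fct_mulD fct_mulN fct_mulM fct_mulC.

(* x |-> idfun *)
Definition fct_unit_alg : ahom (poly_coalg R) FC := @aeval R F (@idfun R).

Let unitX : fct_unit_alg 'X = @idfun R.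
Proof. exact: aevalX. Qed.

Let unit_comp B (u : ahom F B) : (u \c fct_unit_alg) 'X = u (@idfun R).
Proof. by rewrite -unitX. Qed.

Fact fct_unitD B (u v : ahom F B) : hadd fct_ops u v \c fct_unit_alg =
  hadd (poly_ops R) (u \c fct_unit_alg) (v \c fct_unit_alg).
Proof.
apply: poly_hom_ext; rewrite poly_haddX !unit_comp.
have [k [a [b [c [-> -> _]]]]] := fct_triple u v v.
by rewrite fct_haddE; apply: (rmorphD k a b).
Qed.
Fact fct_unitM B (u v : ahom F B) : hmul fct_ops u v \c fct_unit_alg =
  hmul (poly_ops R) (u \c fct_unit_alg) (v \c fct_unit_alg).
Proof.
apply: poly_hom_ext; rewrite poly_hmulX !unit_comp.
have [k [a [b [c [-> -> _]]]]] := fct_triple u v v.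
by rewrite fct_hmulE; apply: (rmorphM k a b).
Qed.
Fact fct_unitN B (u : ahom F B) : hopp fct_ops u \c fct_unit_alg =
  hopp (poly_ops R) (u \c fct_unit_alg).
Proof.
apply: poly_hom_ext; rewrite poly_hoppX !unit_comp.
exact: (rmorphN u (@idfun R : F)).
Qed.
Fact fct_unitC B r : hcst fct_ops B r \c fct_unit_alg = hcst (poly_ops R) B r.
Proof. by apply: poly_hom_ext; rewrite poly_hcstX unit_comp. Qed.

Definition fct_unit : cohom (poly_coalg R) FC :=
  @mk_cohom R (poly_coalg R) FC fct_unit_alg
    fct_unitD fct_unitN fct_unitM fct_unitC.

Fact fct_assoc : fct_mul \c odot_map fct_mul (cohom_id FC) =
  fct_mul \c odot_map (aid FC) fct_mul \c oassoc FC FC FC.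
Proof.
apply: (can_inj (@ocurryK _ _ _ _)); apply: (can_inj (@ocurryK _ _ _ _)).
apply: ahom_ext => a; apply: ahom_ext => b; apply: ahom_ext => c.
rewrite !ocurryE -[LHS]/(fct_mul_alg (odot_map fct_mul (cohom_id FC) _)) odot_mapE.
rewrite -[RHS]/(fct_mul_alg (odot_map (aid FC) fct_mul (oassoc FC FC FC _))).
by rewrite oassocE odot_mapE !fct_mulE.
Qed.

Fact fct_unitl : fct_mul \c odot_map fct_unit (cohom_id FC) = ounitl FC.
Proof.
apply: (can_inj (@ocurryK _ _ _ _)); apply: poly_hom_ext; apply: ahom_ext => t.
rewrite !ocurryE ounitlE -[LHS]/(fct_mul_alg (odot_map fct_unit (cohom_id FC) _)).
by rewrite odot_mapE fct_mulE -[fct_unit 'X]/(fct_unit_alg 'X) unitX.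
Qed.

Fact fct_unitr : fct_mul \c odot_map (aid FC) fct_unit = ounitr FC.
Proof.
apply: (can_inj (@ocurryK _ _ _ _)); apply: ahom_ext => t; apply: poly_hom_ext.
rewrite !ocurryE ounitrE -[LHS]/(fct_mul_alg (odot_map (aid FC) fct_unit _)).
by rewrite odot_mapE fct_mulE -[fct_unit 'X]/(fct_unit_alg 'X) unitX.
Qed.

Definition fct_tw : tw_monoid R := TWMonoid fct_assoc fct_unitl fct_unitr.

End FunctionAlgebra.

(* Main.v *)
(** Both sides carry the co-operations and the multiplication that are forced on
    their generators (the class of x, resp. the identity function) by those of
    R[x], so evaluation is a morphism of Tall-Wraith monoids.  It is injective
    because a nonzero polynomial of degree less than q = |R| cannot vanish at all
    the q points of R, and surjective because 1 - (x - a)^(q - 1) is the indicator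
    function of a. *)

Require Import Defs.
From mathcomp Require Import all_boot all_algebra finfield.
From mathcomp Require Import boolp functions.
Import GRing.Theory.
Local Open Scope ring_scope.

Set Implicit Arguments.
Unset Strict Implicit.
Unset Printing Implicit Defensive.

Lemma fct_algXE (R : finFieldType) (X : Type) (f : fct_alg R X) m a :
  (f ^+ m) a = (f : X -> R) a ^+ m.
Proof. exact: (rmorphXn (evalat R a)). Qed.

(** Makes root counting with [horner] available for the evaluation that defines maps out of R[x]. *)
Lemma aeval_baseE (R : comNzRingType) (r : R) (u : {poly R}) :
  @aeval R (base R) r u = u.[r].
Proof.
elim/poly_ind: u => [|u c IHu]; first by rewrite rmorph0 horner0.
rewrite rmorphD rmorphM IHu aevalX -[c%:P]/(calg_in (poly_alg R) c) ahom_in.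
by rewrite hornerMXaddC.
Qed.

(** A nonzero polynomial has fewer distinct roots than its size, whereas [enum R] would supply
    [#|R|] of them. *)
Lemma poly_all_roots_eq0 (R : finFieldType) (u : {poly R}) :
  (size u <= #|R|)%N -> (forall r, u.[r] = 0) -> u = 0.
Proof.
move=> le_u u0; apply/eqP; apply: contraLR le_u => u_neq0; rewrite -ltnNge cardE.
apply: max_poly_roots (enum_uniq R) => //.
by apply/allP => r _; rewrite rootE u0.
Qed.

Section Evaluation.
Variables (R : finFieldType) (p n : nat).
Hypothesis charR : p \in [pchar R].
Hypothesis cardR : #|R| = (p ^ n)%N.
Local Notation q := (p ^ n)%N.
Local Notation Q := (quot_coalg charR cardR).
Local Notation FC := (fct_coalg R).
Local Notation x := (quot_proj R p n 'X).

Fact fct_unitX : fct_unit_alg R 'X = @idfun R.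
Proof. exact: aevalX. Qed.

(** Pointwise this is [r ^+ q = r] in the field; it lets the unit of the function monoid descend to
    the quotient. *)
Fact fct_unit_expr : fct_unit_alg R 'X ^+ q = fct_unit_alg R 'X.
Proof.
by rewrite fct_unitX; apply: funext => r; rewrite fct_algXE -cardR expf_card.
Qed.

Definition eta_alg : ahom Q FC := qlift cardR fct_unit_expr.

Lemma eta_projE u : eta_alg (quot_proj R p n u) = fct_unit_alg R u.
Proof. by rewrite -[in RHS](qlift_proj cardR fct_unit_expr). Qed.

Lemma eta_projX : eta_alg x = @idfun R.
Proof. by rewrite eta_projE fct_unitX. Qed.

Lemma fct_unit_algE (u : {poly R}) r : (fct_unit_alg R u : R -> R) r = u.[r].
Proof.
(* Two homomorphisms from R[x] to R that agree at ['X]. *)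
have e : evalat R r \c fct_unit_alg R = @aeval R (base R) r.
  by apply: poly_hom_ext; rewrite aevalX -[LHS]/(fct_unit_alg R 'X r) fct_unitX.
by rewrite -aeval_baseE -e.
Qed.

(** Maps out of the quotient are determined at the class of x, where the claim becomes the same
    compatibility for [fct_unit_alg]. The other operations go the same way. *)
Fact eta_add B (u v : ahom FC B) :
  hadd (fct_ops R) u v \c eta_alg =
    hadd (coalg_ops Q) (u \c eta_alg) (v \c eta_alg).
Proof.
apply: quot_hom_ext; rewrite [RHS]quot_haddX.
rewrite -![(_ \c eta_alg) _]/(_ (eta_alg x)).
rewrite eta_projE -[LHS]/((hadd (fct_ops R) u v \c fct_unit_alg R) 'X) fct_unitD.
exact: poly_haddX.
Qed.

Fact eta_mul B (u v : ahom FC B) :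
  hmul (fct_ops R) u v \c eta_alg =
    hmul (coalg_ops Q) (u \c eta_alg) (v \c eta_alg).
Proof.
apply: quot_hom_ext; rewrite [RHS]quot_hmulX.
rewrite -![(_ \c eta_alg) _]/(_ (eta_alg x)).
rewrite eta_projE -[LHS]/((hmul (fct_ops R) u v \c fct_unit_alg R) 'X) fct_unitM.
exact: poly_hmulX.
Qed.

Fact eta_opp B (u : ahom FC B) :
  hopp (fct_ops R) u \c eta_alg = hopp (coalg_ops Q) (u \c eta_alg).
Proof.
apply: quot_hom_ext; rewrite [RHS]quot_hoppX.
rewrite -![(_ \c eta_alg) _]/(_ (eta_alg x)).
rewrite eta_projE -[LHS]/((hopp (fct_ops R) u \c fct_unit_alg R) 'X) fct_unitN.
exact: poly_hoppX.
Qed.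

Fact eta_cst B r : hcst (fct_ops R) B r \c eta_alg = hcst (coalg_ops Q) B r.
Proof.
apply: quot_hom_ext; rewrite [RHS]quot_hcstX -[LHS]/(hcst (fct_ops R) B r (eta_alg x)).
rewrite eta_projE -[LHS]/((hcst (fct_ops R) B r \c fct_unit_alg R) 'X) fct_unitC.
exact: poly_hcstX.
Qed.

Definition eta_cohom : cohom Q FC :=
  @mk_cohom R Q FC eta_alg eta_add eta_opp eta_mul eta_cst.

Fact eta_tw_mul : eta_cohom \c tw_mul (quot_tw charR cardR) =
  tw_mul (fct_tw R) \c odot_map eta_cohom eta_cohom.
Proof.
apply: (can_inj (@ocurryK _ _ _ _)).
(* After currying twice, only the value at [ogen x x] remains to be compared. *)
apply: quot_hom_ext; apply: quot_hom_ext.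
rewrite !ocurryE -[LHS]/(eta_alg (tw_mul (quot_tw charR cardR) _)).
rewrite -[RHS]/(fct_mul_alg R (odot_map eta_cohom eta_cohom _)) odot_mapE fct_mulE.
rewrite -[eta_cohom x]/(eta_alg x).
rewrite [X in eta_alg X](_ : _ = x) ?eta_projX //.
by rewrite [LHS]ouncurryE quot_curryX.
Qed.

Fact eta_tw_unit :
  eta_cohom \c tw_unit (quot_tw charR cardR) = tw_unit (fct_tw R).
Proof.
apply: poly_hom_ext; rewrite -[RHS]/(fct_unit_alg R 'X) -eta_projE.
by rewrite -[LHS]/(eta_alg (aeval (x : Q) 'X)) aevalX.
Qed.

Definition eta_tw : tw_hom (quot_tw charR cardR) (fct_tw R) :=
  @TWHom R (quot_tw charR cardR) (fct_tw R) eta_cohom eta_tw_mul eta_tw_unit.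

Lemma eta_inj : injective eta_alg.
Proof.
apply: raddf_inj => u u0; apply: val_inj; apply: poly_all_roots_eq0.
  (* The representative is reduced modulo a polynomial of size [q.+1], so its size is at most
     [q]. *)
  rewrite cardR -ltnS; apply: leq_trans (size_mk_monic _) _.
  by rewrite quot_monic // quot_size.
move=> r; rewrite -fct_unit_algE -eta_projE.
by rewrite (quot_projK (u : quot_alg R p n)) u0.
Qed.

Definition indicator_poly (a : R) : {poly R} := 1 - ('X - a%:P) ^+ q.-1.

Lemma indicator_polyE a b : (indicator_poly a).[b] = (b == a)%:R.
Proof.
have q_gt1 : (1 < q)%N by rewrite -cardR finNzRing_gt1.
rewrite !hornerE -subr_eq0; case: eqVneq => [->|ba].
  (* Since [q.-1] is positive, the power of 0 is 0 and not 1. *)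
  by rewrite expr0n -[_ == 0%N]negbK -lt0n -ltnS prednK ?(ltnW q_gt1) // q_gt1 subr0.
(* Multiplying by the nonzero [b - a] turns the claim into [(b - a) ^+ q = b - a]. *)
apply/eqP; rewrite subr_eq0 eq_sym; apply/eqP; apply: (mulfI ba).
by rewrite -exprS prednK ?(ltnW q_gt1) // -cardR expf_card mulr1.
Qed.

(** Lagrange interpolation through all points of R, taken modulo [x^q - x]. *)
Definition interpolate (f : fct_alg R R) : quot_alg R p n :=
  \sum_a calg_in (quot_alg R p n) (f a) * quot_proj R p n (indicator_poly a).

Lemma interpolateK : cancel interpolate eta_alg.
Proof.
move=> f; rewrite [RHS]delta_decomp rmorph_sum; apply: eq_bigr => a _.
rewrite rmorphM ahom_in eta_projE; congr (_ * _).
by apply: funext => b; rewrite fct_unit_algE indicator_polyE.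
Qed.

Lemma eta_bij : bijective eta_alg.
Proof.
exists interpolate; last exact: interpolateK.
(* Injectivity makes the right inverse two-sided. *)
exact: inj_can_sym interpolateK eta_inj.
Qed.

End Evaluation.

Theorem theorem7p2 (R : finFieldType) (p n : nat)
    (charR : p \in [pchar R]) (cardR : #|R| = (p ^ n)%N) :
  exists eta : tw_hom (quot_tw charR cardR) (fct_tw R),
    bijective eta /\ eta (quot_proj R p n 'X) = (@idfun R : R -> R).
Proof.
by exists (eta_tw charR cardR); split; [apply: eta_bij | apply: eta_projX].
Qed.
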